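(* Let $S_1,S_2,\ldots$ be i.i.d. copies of a discrete generalized Pareto random variable $S$ with tail index $\beta>0$ and slowly varying function $L$. Let $(k_n)$ be a sequence of real numbers such that, as $n\to+\infty$, $k_n\to+\infty$ and $(\ln n)\exp(k_n\beta)/n=o(L(\exp(k_n)))$. Then $$\widehat\beta_n(k_n)\to\beta\quad\text{almost surely, as } n\to+\infty.$$
   Context: $S$ is a random variable with values in $\{1,2,3,\ldots\}$ such that $\mathbb{P}(S>x)=x^{-\beta}L(x)$ for all real $x\geq 1$, where $\beta>0$ and $L:\mathbb{R}_+\to\mathbb{R}$ is slowly varying, i.e. $L(\lambda z)/L(z)\to 1$ as $z\to+\infty$ for every $\lambda>0$. For real $l$, $\widehat p^{(n)}_l=\frac1n\sum_{i=1}^n\mathbb{I}\{S_i>e^l\}$. The estimator is $\widehat\beta_n(k)=\ln(\widehat p^{(n)}_k)-\ln(\widehat p^{(n)}_{k+1})$ if $\widehat p^{(n)}_{k+1}>0$, and $\widehat\beta_n(k)=0$ if $\widehat p^{(n)}_{k+1}=0$. *)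

(* Defs.v *)
From HB Require Import structures.
From mathcomp Require Import all_boot all_order all_algebra finmap.
From mathcomp Require Import all_classical all_reals all_analysis.

Set Implicit Arguments.
Unset Strict Implicit.
Unset Printing Implicit Defensive.

Import Order.TTheory GRing.Theory Num.Theory.
Import numFieldNormedType.Exports.

Local Open Scope classical_set_scope.
Local Open Scope ring_scope.

(* A function on the nonnegative reals is represented by a total function
   R -> R; its values at negative arguments are never used.  Although division
   by zero is total (x / 0 = 0), the limit 1 forces L z != 0 for all large z. *)
Definition slowly_varying (R : realType) (L : R -> R) : Prop :=
  forall lam : R, 0 < lam -> (L (lam * z) / L z) @[z --> +oo] --> (1 : R).

Section random_variables.
Context d (T : measurableType d) (R : realType) (P : probability T R).

(* The type nat carries its discrete sigma-algebra. *)
Definition discrete_generalized_pareto (beta : R) (L : R -> R)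
    (S : {RV P >-> nat}) : Prop :=
  [/\ 0 < beta,
      slowly_varying L,
      forall w, (0 < S w)%N &
      forall x : R, 1 <= x ->
        P [set w | x < (S w)%:R] = (x `^ (- beta) * L x)%:E].

Definition mutually_independent (X : nat -> {RV P >-> nat}) : Prop :=
  forall (J : {fset nat}) (A : nat -> set nat),
    (forall i, i \in J -> measurable (A i)) ->
    P (\bigcap_(i in [set` J]) (X i @^-1` A i)) =
    (\prod_(i <- J) P (X i @^-1` A i))%E.

Definition same_distribution (X Y : {RV P >-> nat}) : Prop :=
  forall A : set nat, measurable A -> distribution P X A = distribution P Y A.

Definition iid_copies (X : nat -> {RV P >-> nat}) (S : {RV P >-> nat}) : Prop :=
  mutually_independent X /\ forall i, same_distribution (X i) S.

(* The observations S_1, ..., S_n are X 0, ..., X n.-1. *)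
Definition phat (X : nat -> {RV P >-> nat}) (n : nat) (l : R) (w : T) : R :=
  n%:R^-1 * \sum_(i < n) \1_[set w' | expR l < (X i w')%:R] w.

Definition beta_hat (X : nat -> {RV P >-> nat}) (n : nat) (k : R) (w : T) : R :=
  if 0 < phat X n (k + 1) w
  then ln (phat X n k w) - ln (phat X n (k + 1) w)
  else 0.

End random_variables.

(* Main.v *)
Require Import Defs.
From HB Require Import structures.
From mathcomp Require Import all_boot all_order all_algebra finmap.
From mathcomp Require Import all_classical all_reals all_analysis.
From mathcomp Require Import measurable_realfun ring lra.

Import Order.TTheory GRing.Theory Num.Theory.
Import numFieldNormedType.Exports.

Local Open Scope classical_set_scope.
Local Open Scope ring_scope.

(** Write q(l) for the probability that S exceeds exp l.  The hypothesis on k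
    says exactly that ln n is negligible against n * q(k n)
    ([log_negligible_tail]): the expected number of observations above the
    threshold exp (k n) grows faster than ln n.  Slow variation gives
    q(k n + 1) / q(k n) --> exp (- beta) ([cvg_tail_ratio]), so the same holds
    at the threshold k n + 1.

    The number N of exceedances among the first n observations counts
    independent events of common probability p = q(k n), whence a Chernoff bound
    ([chernoff_count]): N / (n p) differs from 1 by a fixed relative error
    with probability at most exp (- c n p), which eventually is at most n^-2
    because n p outgrows every multiple of ln n.  Borel-Cantelli
    ([ae_not_frequently]) then gives N / (n p) --> 1 almost surely
    ([ae_count_equiv_mean], [ae_phat_div_tail]).  Since Borel-Cantelli
    only sums probabilities, the events counted may change with n, as they must
    for a moving threshold k n.

    Finally, the estimator is eventually
    ln (phat_k / q_k) - ln (phat_(k+1) / q_(k+1)) - ln (q_(k+1) / q_k), which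
    tends to 0 - 0 + beta. *)

(** * Borel-Cantelli and an exponential bound *)

(** Apply 1 - x <= exp (- x) and compare 1 / (1 - x) with the quadratic.  Negative
    x is included so that a Chernoff argument can treat both tails at once. *)
Lemma expR_le_quadratic {R : realType} {x : R} :
  x <= 2^-1 -> expR x <= 1 + x + 2 * x ^+ 2.
Proof.
move=> x2.
have x1 : 0 < 1 - x by lra.
have := expR_ge1Dx (- x); rewrite expRN => e1.
have : expR x * (1 - x) <= 1.
  by rewrite mulrC -ler_pdivlMr ?expR_gt0// div1r.
rewrite -ler_pdivlMr// => /le_trans; apply.
rewrite ler_pdivrMr//.
have := sqr_ge0 x; nra.
Qed.

Section borel_cantelli_inv_sqr.
Context {d : measure_display} {T : measurableType d} {R : realType}
  {P : probability T R}.
Local Open Scope ereal_scope.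

(** The index is shifted past the exceptional ranks, after which n^-2 is
    dominated by the telescoping differences of the harmonic sequence. *)
Lemma ae_not_frequently (E : (set T)^nat) :
  (forall n, measurable (E n)) ->
  (\forall n \near \oo, P (E n) <= ((n%:R : R) ^- 2)%:E) ->
  {ae P, forall w, \forall n \near \oo, ~ E n w}.
Proof.
move=> mE [N _ PE].
pose F n := E (n + N.+2)%N.
have PF n : P (F n) <= (harmonic n - harmonic n.+1 : R)%:E.
  apply: (le_trans (PE _ _)) => /=; first by rewrite (leq_trans _ (leq_addl _ _))// leqW.
  rewrite lee_fin natrD -!natr1.
  have n0 : (0 <= n%:R :> R)%R by [].
  have N0 : (0 <= N%:R :> R)%R by [].
  have -> : ((n%:R + 1)^-1 - (n%:R + 1 + 1)^-1 = ((n%:R + 1) * (n%:R + 1 + 1))^-1 :> R)%R.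
    by field; apply/andP; split; rewrite gt_eqF//; lra.
  rewrite lef_pV2 ?posrE ?expr2; [apply: ler_pM; lra|nra|nra].
have F0 : P (lim_sup_set F) = 0.
  apply: lim_sup_set_cvg0 => [n|]; first exact: mE.
  apply: (@le_lt_trans _ _ 1); last exact: ltry.
  apply: lime_le; first by apply: is_cvg_nneseries => n _ _; exact: measure_ge0.
  apply: nearW => n.
  apply: (@le_trans _ _ (\sum_(0 <= i < n) (harmonic i - harmonic i.+1 : R)%:E)).
    by apply: lee_sum => i _; exact: PF.
  rewrite sumEFin lee_fin (@telescope_sumr_eq _ _ _ (fun i => - harmonic i)%R) //=.
    have : (0 < n.+1%:R^-1 :> R)%R by rewrite invr_gt0.
    by rewrite invr1 opprK => h; rewrite gerDr oppr_le0 ltW.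
  by move=> i _; rewrite opprK addrC.
exists (lim_sup_set F); split => //.
  by apply: bigcap_measurable => // n _; apply: bigcup_measurable => i _; exact: mE.
move=> w /= nw n _; apply: contrapT => nF; apply: nw.
exists (n + N.+2)%N => //= m nm Em; apply: nF.
exists (m - N.+2)%N => /=; first by rewrite leq_subRL ?(leq_trans _ nm)// ?leq_addl// addnC.
by rewrite /F subnK// (leq_trans _ nm)// leq_addl.
Qed.

End borel_cantelli_inv_sqr.

(** * A Chernoff bound for independent events of equal probability *)

Section independent_events.
Context {d : measure_display} {T : measurableType d} {R : realType}
  {P : probability T R}.
Context {A : nat -> set T} {p : R}.
Context (mA : forall i, measurable (A i)).
(* The case J = fset1 i says that A i has probability p. *)
Context (PA : forall J : {fset nat},
  P (\bigcap_(i in [set` J]) A i) = (p ^+ #|` J|)%:E).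

Let integrable_indic_prod (D : set T) (a : R) (n : nat) : measurable D ->
  P.-integrable setT
    (EFin \o (fun w => \1_D w * \prod_(i < n) (1 + a * \1_(A i) w))).
Proof.
move=> mD; apply: measurable_bounded_integrable => //.
- by rewrite (le_lt_trans (probability_le1 P measurableT))// ltry.
- apply: measurable_funM => //.
  apply: measurable_prod => i _; apply: measurable_funD => //.
  exact: measurable_funM.
- exists ((1 + `|a|) ^+ n); split; first exact: num_real.
  move=> M ltM w _ /=; rewrite (le_trans _ (ltW ltM))//.
  rewrite normrM normr_prod -[leRHS]mul1r ler_pM ?prodr_ge0//.
    by rewrite indicE; case: (_ \in _); rewrite ?normr1 ?normr0.
  rewrite -[X in _ ^+ X]card_ord -prodr_const; apply: ler_prod => i _.
  rewrite normr_ge0/= (le_trans (ler_normD _ _))// normr1 lerD2l normrM.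
  rewrite indicE; case: (_ \in _); rewrite ?normr1 ?normr0 ?mulr1//.
  by rewrite mulr0.
Qed.

Let bigcap_measurable_fset (J : {fset nat}) :
  measurable (\bigcap_(i in [set` J]) A i).
Proof. by apply: bigcap_measurableType => i _; exact: mA. Qed.

(** With a = exp t - 1 and J empty this is the moment generating function of the
    number of events that occur.  The extra intersection over J makes the
    induction close: expanding the last factor of the product either drops the
    index n or moves it into J, and the product rule for intersections settles
    the case of an empty product. *)
Lemma Rintegral_indic_prod (a : R) (n : nat) (J : {fset nat}) :
  (forall i, i \in J -> (n <= i)%N) ->
  \int[P]_w (\1_(\bigcap_(i in [set` J]) A i) w *
             \prod_(i < n) (1 + a * \1_(A i) w)) =
  p ^+ #|` J| * (1 + a * p) ^+ n.
Proof.
elim: n J => [|n IH] J nJ.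
  rewrite expr0 mulr1 /Rintegral.
  under eq_integral do rewrite big_ord0 mulr1.
  by rewrite integral_indic// setIT [X in fine X]PA.
have nJ' : n \notin J by apply/negP => /nJ; rewrite ltnn.
under eq_Rintegral => w _.
  rewrite big_ord_recr/= mulrDr mulr1 mulrDr.
  rewrite (_ : \1_(\bigcap_(i in [set` J]) A i) w *
    (\prod_(i < n) (1 + a * \1_(A i) w) * (a * \1_(A n) w)) =
    a * (\1_(\bigcap_(i in [set` (n |` J)%fset]) A i) w *
      \prod_(i < n) (1 + a * \1_(A i) w))); last first.
    by rewrite bigcap_fsetU1 indicI /=; ring.
  over.
rewrite RintegralD//; first last.
- under [EFin \o _]eq_fun => w do rewrite /= EFinM.
  by apply: integrableZl => //; exact: integrable_indic_prod.
- exact: integrable_indic_prod.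
rewrite RintegralZl//; last exact: integrable_indic_prod.
rewrite IH ?IH ?cardfsU1 ?nJ'//.
- by rewrite /= add1n !exprS; ring.
- by move=> i /nJ/ltnW.
- by move=> i; rewrite !inE => /orP[/eqP->//|/nJ/ltnW].
Qed.

Let measurable_count (n : nat) (t : R) :
  measurable_fun setT (fun w => t * \sum_(i < n) \1_(A i) w).
Proof.
apply: measurable_funM => //; apply: measurable_sum => i.
exact: measurable_indic.
Qed.

Lemma measurable_count_ge (n : nat) (t a : R) :
  measurable [set w | a <= t * \sum_(i < n) \1_(A i) w].
Proof.
have -> : [set w | a <= t * \sum_(i < n) \1_(A i) w] =
    setT `&` (fun w => t * \sum_(i < n) \1_(A i) w) @^-1` `[a, +oo[.
  by rewrite setTI; apply/seteqP; split => w /=; rewrite in_itv/= andbT.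
exact: measurable_count.
Qed.

(** The sign of t is free: t > 0 bounds the upper tail of the count and t < 0
    its lower tail. *)
Lemma chernoff_count (n : nat) (t a : R) : t <= 2^-1 -> 0 <= p ->
  (P [set w | a <= t * \sum_(i < n) \1_(A i) w]%R <=
   (expR (n%:R * p * (t + 2 * t ^+ 2) - a))%:E)%E.
Proof.
move=> t2 p0.
pose N w : R := t * \sum_(i < n) \1_(A i) w.
have mN : measurable_fun setT N := measurable_count n t.
pose N' : {RV P >-> R} := HB.pack_for {RV P >-> R} N (isMeasurableFun.Build _ _ _ _ N mN).
have := @chernoff _ _ _ P N' 1 a ltr01; rewrite mul1r => /le_trans; apply.
(* An indicator takes the values 0 and 1, so exp (t * 1_A) is affine in 1_A. *)
have eN w : expR (N w * 1) =
    \prod_(i < n) (1 + (expR t - 1) * \1_(A i) w).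
  rewrite mulr1 /N mulr_sumr expR_sum; apply: eq_bigr => i _.
  by rewrite indicE; case: (_ \in _); rewrite ?mulr1 ?mulr0 ?expR0 ?addr0 // addrC subrK.
rewrite /mmt_gen_fun unlock.
have -> : (\int[P]_w ((expR \o 1 \o* N') w)%:E =
    ((1 + (expR t - 1) * p) ^+ n)%:E)%E.
  have no0 i : i \in (fset0 : {fset nat}) -> (n <= i)%N by rewrite inE.
  have := @Rintegral_indic_prod (expR t - 1) n fset0 no0.
  rewrite cardfs0 expr0 mul1r => <-.
  rewrite /Rintegral fineK; last first.
    by apply: integrable_fin_num => //; exact: integrable_indic_prod.
  apply: eq_integral => w _ /=; rewrite eN.
  by rewrite set_fset0 bigcap_set0 indicT mul1r.
rewrite -EFinM lee_fin expRD ler_pM2r ?expR_gt0//.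
have e1 : expR t - 1 <= t + 2 * t ^+ 2.
  by have := expR_le_quadratic t2; lra.
have e0 : 0 <= 1 + (expR t - 1) * p.
  have p1 : p <= 1.
    have := @probability_le1 _ _ _ P _ (bigcap_measurable_fset [fset 0%N]%fset).
    by rewrite PA cardfs1 expr1 lee_fin.
  have := mulr_ge0 (expR_ge0 t) p0; lra.
rewrite -mulrA expRM_natl lerXn2r ?nnegrE ?expR_ge0//.
apply: le_trans (expR_ge1Dx _); rewrite lerD2l mulrC ler_wpM2l//.
Qed.

End independent_events.

(** * Law of large numbers for counts in a triangular array *)

Section triangular_array.
Context {d : measure_display} {T : measurableType d} {R : realType}
  {P : probability T R}.
Context {A : nat -> nat -> set T} {p : nat -> R}.
Context (mA : forall n i, measurable (A n i)).
Context (PA : forall n (J : {fset nat}),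
  P (\bigcap_(i in [set` J]) A n i) = (p n ^+ #|` J|)%:E).
Context (p_gt_log : forall C : R,
  \forall n \near \oo, C * ln n%:R <= n%:R * p n).

Let p_ge0 n : 0 <= p n.
Proof.
by rewrite -lee_fin -[p n]expr1 -(cardfs1 0%N) -PA measure_ge0.
Qed.

(** The threshold exceeds the Chernoff exponent n p (t + 2 t^2) by 2 t^2 n p,
    which is at least 2 ln n once n p >= t^-2 ln n; the failure probability is
    then at most n^-2. *)
Lemma ae_count_lt (t : R) : t != 0 -> t <= 2^-1 ->
  {ae P, forall w, \forall n \near \oo,
    t * \sum_(i < n) \1_(A n i) w < n%:R * p n * (t + 4 * t ^+ 2)}.
Proof.
move=> t0 t2.
have t20 : 0 < t ^+ 2 by rewrite exprn_even_gt0.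
pose E n := [set w | n%:R * p n * (t + 4 * t ^+ 2) <=
                     t * \sum_(i < n) \1_(A n i) w].
have : {ae P, forall w, \forall n \near \oo, ~ E n w}.
  apply: ae_not_frequently => [n|]; first exact: measurable_count_ge.
  near=> n.
  apply: (le_trans (chernoff_count (mA n) (PA n) n t _ t2 (p_ge0 n))).
  have n0 : (0 : R) < n%:R by rewrite ltr0n; near: n; exact: nbhs_infty_gt.
  rewrite lee_fin -[X in _ <= X ^- 2](lnK n0) -expRM_natl -expRN ler_expR.
  have : (t ^+ 2)^-1 * ln n%:R <= n%:R * p n by near: n; exact: p_gt_log.
  by rewrite mulrC ler_pdivrMr//; nra.
apply: filterS => w; apply: filterS => n /negP.
by rewrite -ltNge.
Unshelve. all: by end_near. Qed.

(** Dividing [ae_count_lt] for t and - t by |t| n p shows that the ratio of the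
    count to its mean is eventually within 4 |t| of 1; a sequence of values t
    tending to 0 keeps the exceptional sets countable. *)
Lemma ae_count_equiv_mean :
  {ae P, forall w,
    n%:R^-1 * (\sum_(i < n) \1_(A n i) w) / p n @[n --> \oo] --> (1 : R)}.
Proof.
pose t (j : nat) : R := (2 * j.+1%:R)^-1.
have t0 j : 0 < t j by rewrite invr_gt0 mulr_gt0.
have t2 j : t j <= 2^-1.
  by rewrite lef_pV2 ?posrE// ?mulr_gt0// ler_peMr// ler1n.
have up : {ae P, forall w j, \forall n \near \oo,
    t j * \sum_(i < n) \1_(A n i) w < n%:R * p n * (t j + 4 * t j ^+ 2)}.
  by apply: ae_foralln => j; apply: ae_count_lt => //; rewrite gt_eqF.
have lo : {ae P, forall w j, \forall n \near \oo,
    - t j * \sum_(i < n) \1_(A n i) w <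
    n%:R * p n * (- t j + 4 * (- t j) ^+ 2)}.
  apply: ae_foralln => j; apply: ae_count_lt; first by rewrite oppr_eq0 gt_eqF.
  by rewrite (le_trans _ (t2 j))// ge0_cp// ltW.
apply: filterS2 up lo => w up lo.
apply/cvgrPdist_lt => e e0.
have [j je] : exists j, 4 * t j < e.
  have e4 : 0 < e / 4 by rewrite divr_gt0.
  have [j _ /(_ j (leqnn j)) /= je] := near_infty_natSinv_lt (PosNum e4).
  exists j; apply: le_lt_trans (_ : _ <= 4 * j.+1%:R^-1) _; last by rewrite mulrC -ltr_pdivlMr.
  by rewrite ler_pM2l// /t invfM ler_piMl// invf_le1// ler1n.
near=> n.
have n1 : (1 < n)%N by near: n; exact: nbhs_infty_gt.
have m0 : 0 < n%:R * p n.
  apply: (@lt_le_trans _ _ (1 * ln n%:R)); first by rewrite mul1r ln_gt0// ltr1n.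
  by near: n; exact: p_gt_log.
rewrite mulrAC -invfM [X in 1 - X]mulrC.
have upn : t j * \sum_(i < n) \1_(A n i) w <
    n%:R * p n * (t j + 4 * t j ^+ 2) by near: n; exact: (up j).
have lon : - t j * \sum_(i < n) \1_(A n i) w <
    n%:R * p n * (- t j + 4 * (- t j) ^+ 2) by near: n; exact: (lo j).
move: upn lon; set N := \sum_(i < n) _ => upn lon.
have -> : 1 - N / (n%:R * p n) = (n%:R * p n - N) / (n%:R * p n).
  by rewrite mulrBl divff ?gt_eqF.
rewrite normrM normfV [X in _ / X]gtr0_norm// ltr_pdivrMr//.
apply: lt_le_trans (_ : _ < 4 * t j * (n%:R * p n)) _.
  rewrite -(ltr_pM2l (t0 j)) -[X in X * _ < _]gtr0_norm// -normrM ltr_norml.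
  by apply/andP; split; nra.
by rewrite ler_pM2r// ltW.
Unshelve. all: by end_near.
Qed.

End triangular_array.

(** * Tails of discrete generalized Pareto variables *)

Section pareto_tail.
Context {d : measure_display} {T : measurableType d} {R : realType}
  {P : probability T R}.

Definition tail (S : {RV P >-> nat}) (l : R) : R :=
  fine (P [set w | expR l < (S w)%:R]).

Lemma tail_ge0 S l : 0 <= tail S l.
Proof. exact/fine_ge0/measure_ge0. Qed.

Lemma ae_phat_div_tail (S : {RV P >-> nat}) (X : nat -> {RV P >-> nat})
    (l : nat -> R) :
  iid_copies X S ->
  (forall C : R, \forall n \near \oo, C * ln n%:R <= n%:R * tail S (l n)) ->
  {ae P, forall w,
    phat X n (l n) w / tail S (l n) @[n --> \oo] --> (1 : R)}.
Proof.
move=> [indX distX] hC.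
pose B n := [set m : nat | expR (l n) < m%:R].
have PS n : P (S @^-1` B n) = (tail S (l n))%:E.
  have mB : measurable (S @^-1` B n) by exact: (measurable_funPTI S).
  by rewrite /tail fineK// fin_num_measure.
apply: (@ae_count_equiv_mean _ _ _ P (fun n i => X i @^-1` B n)
  (fun n => tail S (l n))) => //.
- by move=> n i; exact: (measurable_funPTI (X i)).
- move=> n J; rewrite indX//.
  rewrite (eq_bigr (fun=> (tail S (l n))%:E)); last first.
    by move=> i _; rewrite -PS; exact: (distX i (B n)).
  by rewrite prodEFin big_const_seq count_predT -Monoid.iteropE.
Qed.

Context {beta : R} {L : R -> R} {S : {RV P >-> nat}}.
Context (hS : discrete_generalized_pareto beta L S).

(** The power law and the slowly varying factor in logarithmic scale, where
    increasing x by 1 multiplies the power law by exp (- beta). *)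
Lemma tailE (x : R) : 0 <= x -> tail S x = expR (- (x * beta)) * L (expR x).
Proof.
move=> x0; case: hS => _ _ _ PS.
have x1 : 1 <= expR x by rewrite (le_trans _ (expR_ge1Dx x))// lerDl.
by rewrite /tail PS//= -mulrN expRM.
Qed.

Lemma cvg_tail_ratio (k : nat -> R) : k n @[n --> \oo] --> +oo ->
  tail S (k n + 1) / tail S (k n) @[n --> \oo] --> expR (- beta).
Proof.
move=> hk; case: (hS) => _ slowL _ _.
have ek : expR (k n) @[n --> \oo] --> +oo.
  apply: (ger_cvgy _ hk); apply: nearW => n.
  by apply: le_trans (expR_ge1Dx _); rewrite lerDr.
have LL : expR (- beta) * (L (expR 1 * expR (k n)) / L (expR (k n)))
    @[n --> \oo] --> expR (- beta).
  rewrite -[X in _ --> X]mulr1; apply: cvgM; first exact: cvg_cst.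
  exact: cvg_comp ek (slowL (expR 1) (expR_gt0 1)).
apply: cvg_trans LL; apply: near_eq_cvg; near=> n.
have k0 : 0 <= k n by near: n; exact: cvgry_ge hk 0.
rewrite /= !tailE ?addr_ge0// [k n + 1]addrC expRD mulrDl mul1r opprD expRD.
have E0 : expR (- (k n * beta)) != 0 by rewrite gt_eqF ?expR_gt0.
(* The inverse of L is generalized to keep [field] from asking for L != 0. *)
by rewrite invfM; move: (L _)^-1 => Li; field.
Unshelve. all: by end_near. Qed.

(** The hypothesis bounds ln n * exp (k n * beta) / n by a small multiple of
    |L (exp (k n))|.  The absolute value disappears because L has the sign of a
    tail probability, and dividing by exp (k n * beta) turns L into the tail. *)
Lemma log_negligible_tail (k : nat -> R) : k n @[n --> \oo] --> +oo ->
  ((fun n : nat => ln (n%:R : R) * expR (k n * beta) / n%:R) =o_\oo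
           (fun n : nat => L (expR (k n)))) ->
  forall C : R, \forall n \near \oo, C * ln n%:R <= n%:R * tail S (k n).
Proof.
move=> hk /eqoP hkL C.
(* C may be nonpositive; the little-o constant is the inverse of max C 1. *)
have C0 : 0 < Num.max C 1 by rewrite lt_max ltr01 orbT.
have Ci : 0 < (Num.max C 1)^-1 by rewrite invr_gt0.
have := hkL _ Ci => {}hkL.
near=> n.
have n0 : (0 < n)%N by near: n; exact: nbhs_infty_gt.
have n0R : (0 : R) < n%:R by rewrite ltr0n.
have lnn0 : 0 <= ln (n%:R : R) by rewrite ln_ge0// ler1n.
have k0 : 0 <= k n by near: n; exact: cvgry_ge hk 0.
have Lge0 : 0 <= L (expR (k n)).
  by have := tail_ge0 S (k n); rewrite tailE// pmulr_rge0// expR_gt0.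
apply: (@le_trans _ _ (Num.max C 1 * ln n%:R)).
  by rewrite ler_wpM2r// le_max lexx.
have : `|ln n%:R * expR (k n * beta) / n%:R| <= (Num.max C 1)^-1 * `|L (expR (k n))|.
  by near: n.
rewrite (ger0_norm Lge0) ger0_norm ?divr_ge0 ?mulr_ge0 ?expR_ge0//.
rewrite ler_pdivrMr// -mulrA ler_pdivlMl// => h.
rewrite tailE// expRN mulrCA ler_pdivlMl ?expR_gt0//.
by rewrite mulrC -mulrA [leRHS]mulrC.
Unshelve. all: by end_near. Qed.

End pareto_tail.

(** * Strong consistency of the estimator *)

Theorem theorem2p1 (d : measure_display) (T : measurableType d) (R : realType)
    (P : probability T R) (beta : R) (L : R -> R)
    (S : {RV P >-> nat}) (X : nat -> {RV P >-> nat}) (k : nat -> R)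
    (hS : discrete_generalized_pareto beta L S)
    (hX : iid_copies X S)
    (hk : k n @[n --> \oo] --> +oo)
    (hkL : (fun n : nat => ln (n%:R : R) * expR (k n * beta) / n%:R) =o_\oo
           (fun n : nat => L (expR (k n)))) :
  {ae P, forall w, beta_hat X n (k n) w @[n --> \oo] --> beta}.
Proof.
have hC := log_negligible_tail hS _ hk hkL.
have hr := cvg_tail_ratio hS _ hk.
have q0 : \forall n \near \oo, 0 < tail S (k n).
  near=> n.
  have n1 : (1 < n)%N by near: n; exact: nbhs_infty_gt.
  rewrite -(@pmulr_rgt0 _ n%:R) ?ltr0n ?(ltnW n1)//.
  apply: (@lt_le_trans _ _ (1 * ln n%:R)).
    by rewrite mul1r ln_gt0// ltr1n.
  by near: n; exact: hC.
(* Half the limiting ratio carries the bound from k n over to k n + 1. *)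
have hr2 : \forall n \near \oo, expR (- beta) / 2 < tail S (k n + 1) / tail S (k n).
  apply: cvgr_gt hr _ _.
  by rewrite ltr_pdivrMr// ltr_pMr ?expR_gt0// ltr1n.
have hC' : forall C : R, \forall n \near \oo,
    C * ln n%:R <= n%:R * tail S (k n + 1).
  move=> C; near=> n.
  have qn : 0 < tail S (k n) by near: n.
  have hn : C / (expR (- beta) / 2) * ln n%:R <= n%:R * tail S (k n).
    by near: n; exact: hC.
  have : expR (- beta) / 2 < tail S (k n + 1) / tail S (k n).
    by near: n.
  rewrite ltr_pdivlMr// => /ltW q2.
  move: hn; rewrite mulrAC ler_pdivrMr ?divr_gt0 ?expR_gt0// => /le_trans; apply.
  by rewrite -mulrA ler_wpM2l// mulrC.
have a1 := ae_phat_div_tail S X k hX hC.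
have a2 := ae_phat_div_tail S X (fun n => k n + 1) hX hC'.
apply: filterS2 a1 a2 => w c1 c2.
have l1 := cvg_comp _ _ c1 (continuous_ln ltr01).
have l2 := cvg_comp _ _ c2 (continuous_ln ltr01).
have l3 := cvg_comp _ _ hr (continuous_ln (expR_gt0 (- beta))).
have lim : ln (phat X n (k n) w / tail S (k n)) -
    ln (phat X n (k n + 1) w / tail S (k n + 1)) -
    ln (tail S (k n + 1) / tail S (k n)) @[n --> \oo] --> beta.
  rewrite (_ : beta = ln 1 - ln 1 - ln (expR (- beta))).
    exact: cvgB (cvgB l1 l2) l3.
  by rewrite expRK subrr sub0r opprK.
apply: cvg_trans lim; apply: near_eq_cvg; near=> n.
have qn : 0 < tail S (k n) by near: n.
have rn : 0 < tail S (k n + 1) / tail S (k n).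
  apply: (@lt_trans _ _ (expR (- beta) / 2)); first by rewrite divr_gt0 ?expR_gt0.
  by near: n.
have qn' : 0 < tail S (k n + 1).
  by move: rn; rewrite pmulr_lgt0// invr_gt0.
have p1 : 0 < phat X n (k n) w.
  have : 0 < phat X n (k n) w / tail S (k n).
    by near: n; exact: cvgr_gt c1 _ ltr01.
  by rewrite pmulr_lgt0// invr_gt0.
have p2 : 0 < phat X n (k n + 1) w.
  have : 0 < phat X n (k n + 1) w / tail S (k n + 1).
    by near: n; exact: cvgr_gt c2 _ ltr01.
  by rewrite pmulr_lgt0// invr_gt0.
by rewrite /= /beta_hat p2 !ln_div ?posrE//; ring.
Unshelve. all: by end_near. Qed.
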